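(* Let $n,\epsilon\in\mathbb{N}$ be positive integers. For every $p(0)\in\triangle^{n-1}\subset\mathbb{R}^n$, the Deffuant-Weisbuch interactive Markov chain $(p(t))_{t\in\mathbb{N}_0}$ defined by $p(t+1)=p(t)B^{\mathrm{DW}}(p(t),\epsilon)$ cannot be periodic outside of fixed points: if $p(t+T)=p(t)$ for some $t\in\mathbb{N}_0$ and some integer $T\ge1$, then $p(t)$ is a fixed point, i.e. $p(t)=p(t)B^{\mathrm{DW}}(p(t),\epsilon)$.
   Context: $\triangle^{n-1}=\{p\in\mathbb{R}^n_{\ge0} \mid \sum_{i=1}^n p_i=1\}$; its elements (opinion distributions) are treated as row vectors, and by convention $p_i=0$ for all integers $i\notin\{1,\dots,n\}$. Deffuant-Weisbuch transition matrix: for $p\in\triangle^{n-1}$ and $i\in\{1,\dots,n\}$ and an integer $m$, put $\pi^i_m:=p_m$ if $|i-m|\le\epsilon$ and $\pi^i_m:=0$ otherwise. Then $B^{\mathrm{DW}}(p,\epsilon)$ is the $n\times n$ matrix with $$B^{\mathrm{DW}}_{ij}(p,\epsilon)=\tfrac12\pi^i_{2j-i-1}+\pi^i_{2j-i}+\tfrac12\pi^i_{2j-i+1}\quad\text{if } i\ne j,$$ $$B^{\mathrm{DW}}_{ii}(p,\epsilon)=1-\sum_{j\ne i,\ j=1}^n B^{\mathrm{DW}}_{ij}(p,\epsilon).$$ *)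

(* Defs.v *)
(* MathComp; the real numbers are an abstract [realType] of MathComp-Analysis. *)
From mathcomp Require Import all_boot all_order all_algebra.
From mathcomp Require Import reals.

Set Implicit Arguments.
Unset Strict Implicit.
Unset Printing Implicit Defensive.

Import Order.TTheory GRing.Theory Num.Theory.
Local Open Scope ring_scope.

Definition in_simplex (R : realType) (n : nat) (p : 'rV[R]_n) : Prop :=
  (forall i : 'I_n, 0 <= p 0 i) /\ \sum_(i < n) p 0 i = 1.

(* The opinions are 1, ..., n, whereas the elements of 'I_n have the values
   0, ..., n - 1. *)
Definition opinion (n : nat) (i : 'I_n) : int := (val i).+1%:Z.

(* At most one k contributes to the sum, and none does when m is not in
   {1, ..., n}. *)
Definition mass (R : realType) (n : nat) (p : 'rV[R]_n) (m : int) : R :=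
  \sum_(k < n | opinion k == m) p 0 k.

Definition confined_mass (R : realType) (n : nat) (p : 'rV[R]_n) (eps : nat)
    (i m : int) : R :=
  if `|i - m| <= eps%:Z then mass p m else 0.

(* The formula for the off-diagonal entries, in terms of opinions. *)
Definition DW_rate (R : realType) (n : nat) (p : 'rV[R]_n) (eps : nat)
    (i j : int) : R :=
  2^-1 * confined_mass p eps i (2 * j - i - 1)
  + confined_mass p eps i (2 * j - i)
  + 2^-1 * confined_mass p eps i (2 * j - i + 1).

Definition DW_matrix (R : realType) (n : nat) (p : 'rV[R]_n) (eps : nat) :
    'M[R]_n :=
  \matrix_(i < n, j < n)
    if i != j then DW_rate p eps (opinion i) (opinion j)
    else 1 - \sum_(k < n | k != i) DW_rate p eps (opinion i) (opinion k).

(* Main.v *)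
(* A meeting of opinions i and k replaces them by the floor and the ceiling of
   their average. Hence, for every test function f, one step changes the sum of
   p_j f(j) by minus half of the sum, over the pairs (i, k) within distance eps,
   of p_i p_k times the defect f(i) + f(k) - f(floor) - f(ceil). For f(j) = j^2
   the defect is nonnegative, and positive as soon as |i - k| >= 2; so the second
   moment is nonincreasing, and along a period it is constant, which forces
   p_i p_k = 0 whenever 2 <= |i - k| <= eps. When |i - k| <= 1 the defect of every
   f vanishes, because the pair is then merely reproduced; taking indicator
   functions for f shows that p is a fixed point. *)
Require Import Defs.
From mathcomp Require Import all_boot all_order all_algebra.
From mathcomp Require Import reals.
From mathcomp Require Import zify ring lra.

Set Implicit Arguments.
Unset Strict Implicit.
Unset Printing Implicit Defensive.

Import Order.TTheory GRing.Theory Num.Theory.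
Local Open Scope ring_scope.

Lemma lower_mid_subproof (n : nat) (i k : 'I_n) : ((i + k)./2 < n)%N.
Proof. by have := ltn_ord i; have := ltn_ord k; lia. Qed.

Lemma upper_mid_subproof (n : nat) (i k : 'I_n) : (uphalf (i + k) < n)%N.
Proof. by have := ltn_ord i; have := ltn_ord k; lia. Qed.

(** Opinions are indices plus 1, and rounding an average commutes with this shift, so midpoints can
    be computed on indices. *)
Definition lower_mid (n : nat) (i k : 'I_n) : 'I_n :=
  Ordinal (lower_mid_subproof i k).

Definition upper_mid (n : nat) (i k : 'I_n) : 'I_n :=
  Ordinal (upper_mid_subproof i k).

Definition near (n eps : nat) (i k : 'I_n) : bool :=
  `|opinion i - opinion k| <= eps%:Z.

Definition defect (R : realType) (n : nat) (f : 'I_n -> R) (i k : 'I_n) : R :=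
  f i + f k - f (lower_mid i k) - f (upper_mid i k).

(** Indices may replace opinions here: affine functions have zero defect, so the shift by 1 does not
    affect the defect of the square. *)
Definition second_moment (R : realType) (n : nat) (p : 'rV[R]_n) : R :=
  \sum_j p 0 j * (j : nat)%:R ^+ 2.

Lemma near_sym (n eps : nat) (i k : 'I_n) : near eps i k = near eps k i.
Proof. by rewrite /near distrC. Qed.

Lemma defect_sym (R : realType) (n : nat) (f : 'I_n -> R) (i k : 'I_n) :
  defect f i k = defect f k i.
Proof.
have -> : defect f k i = f k + f i - f (lower_mid i k) - f (upper_mid i k).
  by congr (_ - f _ - f _); apply: val_inj; rewrite /= addnC.
by rewrite /defect (addrC (f i)).
Qed.

Lemma defect_eq0 (R : realType) (n : nat) (f : 'I_n -> R) (i k : 'I_n) :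
  (i <= k.+1)%N -> (k <= i.+1)%N -> defect f i k = 0.
Proof.
wlog le_ik : i k / (i <= k)%N.
  move=> H ik ki; case/orP: (leq_total i k) => le; first exact: H.
  by rewrite defect_sym; apply: H.
move=> _ ki; rewrite /defect.
have -> : lower_mid i k = i by apply: val_inj => /=; lia.
have -> : upper_mid i k = k by apply: val_inj => /=; lia.
by ring.
Qed.

(** With s = i + k of parity b, the midpoints are (s - b)/2 and (s + b)/2, whose squares add up to
    (s^2 + b)/2 because b^2 = b. *)
Lemma sqr_defectE (R : realType) (n : nat) (i k : 'I_n) :
  defect (fun j => (j : nat)%:R ^+ 2 : R) i k =
  2^-1 * (((i : nat)%:R - (k : nat)%:R) ^+ 2 - (odd (i + k))%:R).
Proof.
rewrite /defect /= uphalf_half natrD.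
have : (i : nat)%:R + (k : nat)%:R = (odd (i + k))%:R + 2 * ((i + k)./2)%:R :> R.
  by rewrite -natrD -{1}(odd_double_half (i + k)) natrD -mul2n natrM.
case: (odd _) => /= H; nra.
Qed.

Lemma sqr_defect_gt0 (R : realType) (n : nat) (i k : 'I_n) :
  ~~ ((i <= k.+1) && (k <= i.+1))%N ->
  0 < defect (fun j => (j : nat)%:R ^+ 2 : R) i k.
Proof.
move=> far; rewrite sqr_defectE pmulr_rgt0 ?invr_gt0 ?ltr0n // subr_gt0.
have odd1 : (odd (i + k))%:R <= 1 :> R by case: odd.
(* A gap of at least 2 makes the squared difference at least 4, which exceeds the parity. *)
have : (i : nat)%:R + 2 <= (k : nat)%:R :> R \/ (k : nat)%:R + 2 <= (i : nat)%:R :> R.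
  by rewrite -!natrD !ler_nat; lia.
by case=> H; nra.
Qed.

Lemma sqr_defect_ge0 (R : realType) (n : nat) (i k : 'I_n) :
  0 <= defect (fun j => (j : nat)%:R ^+ 2 : R) i k.
Proof.
have [/andP[ik ki]|far] := boolP ((i <= k.+1) && (k <= i.+1))%N.
  by rewrite defect_eq0.
exact/ltW/sqr_defect_gt0.
Qed.

Lemma confined_massE (R : realType) (n : nat) (p : 'rV[R]_n) (eps : nat)
    (i : 'I_n) (m : int) :
  confined_mass p eps (opinion i) m =
  \sum_(k < n | near eps i k) p 0 k * (opinion k == m)%:R.
Proof.
rewrite /confined_mass /mass; transitivity
  (\sum_(k < n | near eps i k && (opinion k == m)) p 0 k); last first.
  rewrite big_mkcondr; apply: eq_bigr => k _.
  by case: eqP; rewrite ?mulr1 ?mulr0.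
case: ifPn => le_im.
  by apply: eq_bigl => k; rewrite /near andbC; case: eqP => // ->.
rewrite big_pred0 // => k; rewrite /near.
by case: eqP => [->|]; rewrite ?andbF // (negbTE le_im).
Qed.

(** The partners 2j - i - 1, 2j - i and 2j - i + 1 of i are those for which j is the upper midpoint
    only, both midpoints, or the lower midpoint only; this explains the weights 1/2, 1, 1/2. *)
Lemma DW_rateE (R : realType) (n : nat) (p : 'rV[R]_n) (eps : nat) (i j : 'I_n) :
  DW_rate p eps (opinion i) (opinion j) =
  \sum_(k < n | near eps i k) p 0 k *
    (2^-1 * ((lower_mid i k == j)%:R + (upper_mid i k == j)%:R)).
Proof.
rewrite /DW_rate !confined_massE !mulr_sumr -!big_split /=.
apply: eq_bigr => k _.
have -> : (opinion k == 2 * opinion j - opinion i - 1) = ((i + k).+1 == 2 * j)%N.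
  by rewrite /opinion /=; lia.
have -> : (opinion k == 2 * opinion j - opinion i) = (i + k == 2 * j)%N.
  by rewrite /opinion /=; lia.
have -> : (opinion k == 2 * opinion j - opinion i + 1) = (i + k == (2 * j).+1)%N.
  by rewrite /opinion /=; lia.
rewrite -!val_eqE /= uphalf_half.
have /= := odd_double_half (i + k); rewrite -mul2n; set h := half _.
case: (odd _) => /= <-.
  have -> : ((1 + 2 * h).+1 == 2 * j)%N = (1 + h == j)%N by lia.
  have -> : (1 + 2 * h == 2 * j)%N = false by lia.
  have -> : (1 + 2 * h == (2 * j).+1)%N = (h == j)%N by lia.
  by rewrite mulr0n; ring.
have -> : ((0 + 2 * h).+1 == 2 * j)%N = false by lia.
have -> : (0 + 2 * h == 2 * j)%N = (h == j)%N by lia.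
have -> : (0 + 2 * h == (2 * j).+1)%N = false by lia.
by rewrite !mulr0n add0n; field.
Qed.

Lemma sum_indicator (R : realType) (n : nat) (f : 'I_n -> R) (i : 'I_n) :
  \sum_j (i == j)%:R * f j = f i.
Proof.
rewrite (bigD1 i) //= eqxx mul1r big1 ?addr0 // => j.
by rewrite eq_sym => /negbTE ->; rewrite mul0r.
Qed.

Lemma sum_DW_rate (R : realType) (n : nat) (p : 'rV[R]_n) (eps : nat)
    (f : 'I_n -> R) (i : 'I_n) :
  \sum_j DW_rate p eps (opinion i) (opinion j) * f j =
  \sum_(k < n | near eps i k)
    p 0 k * (2^-1 * (f (lower_mid i k) + f (upper_mid i k))).
Proof.
under eq_bigr => j _ do rewrite DW_rateE mulr_suml.
rewrite exchange_big /=; apply: eq_bigr => k _.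
rewrite -(sum_indicator f (lower_mid i k)) -(sum_indicator f (upper_mid i k)).
rewrite -big_split /= !mulr_sumr; apply: eq_bigr => j _; ring.
Qed.

Lemma DW_rate_ge0 (R : realType) (n : nat) (p : 'rV[R]_n) (eps : nat)
    (i j : 'I_n) :
  (forall k, 0 <= p 0 k) -> 0 <= DW_rate p eps (opinion i) (opinion j).
Proof.
move=> p_ge0; rewrite DW_rateE; apply: sumr_ge0 => k _.
by rewrite !mulr_ge0 // ?addr_ge0 // invr_ge0.
Qed.

Lemma sum_DW_rate_le1 (R : realType) (n : nat) (p : 'rV[R]_n) (eps : nat)
    (i : 'I_n) :
  in_simplex p ->
  \sum_(j < n | j != i) DW_rate p eps (opinion i) (opinion j) <= 1.
Proof.
(* Once the term j = i is added, the sum is the total mass within distance [eps] of i. *)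
case=> p_ge0 p1; apply: (@le_trans _ _
    (\sum_j DW_rate p eps (opinion i) (opinion j) * 1)).
  rewrite big_mkcond; apply: ler_sum => j _.
  by rewrite mulr1; case: ifP => // _; exact: DW_rate_ge0.
rewrite sum_DW_rate -[leRHS]p1 big_mkcond; apply: ler_sum => j _.
by case: ifP => _ /=; have := p_ge0 j; lra.
Qed.

Lemma DW_matrix_ge0 (R : realType) (n : nat) (p : 'rV[R]_n) (eps : nat)
    (i j : 'I_n) :
  in_simplex p -> 0 <= DW_matrix p eps i j.
Proof.
move=> ps; rewrite mxE; case: ifP => _; first by apply: DW_rate_ge0; case: ps.
by rewrite subr_ge0 sum_DW_rate_le1.
Qed.

(** The diagonal entry makes the row sum 1. The factor f(j) - f(i) vanishes at j = i, so the rate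
    formula can be summed over all j, as [sum_DW_rate] requires. *)
Lemma sum_DW_matrix (R : realType) (n : nat) (p : 'rV[R]_n) (eps : nat)
    (f : 'I_n -> R) (i : 'I_n) :
  \sum_j DW_matrix p eps i j * f j =
  f i + \sum_j DW_rate p eps (opinion i) (opinion j) * (f j - f i).
Proof.
rewrite (bigD1 i) //= mxE eqxx /= mulrBl mul1r -addrA; congr (_ + _).
rewrite [in RHS](bigD1 i) //= subrr mulr0 add0r mulr_suml addrC -sumrB.
by apply: eq_bigr => j ji; rewrite mxE eq_sym ji mulrBr.
Qed.

(* The sum over (i, k) is symmetric, so f(i) may be replaced by the average of
   f(i) and f(k). *)
Lemma sum_step (R : realType) (n : nat) (p : 'rV[R]_n) (eps : nat)
    (f : 'I_n -> R) :
  \sum_j (p *m DW_matrix p eps) 0 j * f j =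
  \sum_j p 0 j * f j -
  2^-1 * \sum_i \sum_(k < n | near eps i k) p 0 i * p 0 k * defect f i k.
Proof.
have -> : \sum_j (p *m DW_matrix p eps) 0 j * f j =
    \sum_i p 0 i * \sum_j DW_matrix p eps i j * f j.
  under eq_bigr => j _ do rewrite mxE mulr_suml.
  rewrite exchange_big; apply: eq_bigr => i _; rewrite mulr_sumr.
  by apply: eq_bigr => j _; rewrite mulrA.
under eq_bigr => i _ do rewrite sum_DW_matrix sum_DW_rate mulrDr mulr_sumr.
rewrite big_split /=; congr (_ + _).
have swap : \sum_i \sum_(k < n | near eps i k) p 0 i * p 0 k * f i =
    \sum_i \sum_(k < n | near eps i k) p 0 i * p 0 k * f k.
  rewrite (exchange_big_dep predT) //=; apply: eq_bigr => i _.
  apply: eq_big => [k|k _]; first by rewrite near_sym.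
  by rewrite [p 0 k * _]mulrC.
(* With everything on one side, the midpoint terms cancel and half the difference of the two sums in
   [swap] remains. *)
apply/eqP; rewrite -addr_eq0; apply/eqP.
transitivity (2^-1 *
    (\sum_i \sum_(k < n | near eps i k) p 0 i * p 0 k * f k -
     \sum_i \sum_(k < n | near eps i k) p 0 i * p 0 k * f i)); last first.
  by rewrite swap subrr mulr0.
rewrite -sumrB !mulr_sumr -big_split /=; apply: eq_bigr => i _.
rewrite -sumrB !mulr_sumr -big_split /=; apply: eq_bigr => k _.
by rewrite /defect; field.
Qed.

Lemma in_simplex_step (R : realType) (n : nat) (p : 'rV[R]_n) (eps : nat) :
  in_simplex p -> in_simplex (p *m DW_matrix p eps).
Proof.
move=> ps; have [p_ge0 p1] := ps; split=> [j|].
  by rewrite mxE; apply: sumr_ge0 => i _; rewrite mulr_ge0 ?DW_matrix_ge0.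
(* Mass is conserved because a constant function has zero defect. *)
have := sum_step p eps (fun=> 1).
under eq_bigr => j _ do rewrite mulr1.
under [X in _ = X - _]eq_bigr => j _ do rewrite mulr1.
rewrite p1 => ->; rewrite big1 ?mulr0 ?subr0 // => i _.
by rewrite big1 // => k _; rewrite /defect; ring.
Qed.

Lemma second_moment_step_le (R : realType) (n : nat) (p : 'rV[R]_n) (eps : nat) :
  in_simplex p -> second_moment (p *m DW_matrix p eps) <= second_moment p.
Proof.
case=> p_ge0 _; rewrite /second_moment sum_step gerBl mulr_ge0 ?invr_ge0 //.
apply: sumr_ge0 => i _; apply: sumr_ge0 => k _.
by rewrite !mulr_ge0 ?sqr_defect_ge0.
Qed.

Lemma second_moment_step_eq (R : realType) (n : nat) (p : 'rV[R]_n) (eps : nat) :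
  in_simplex p -> second_moment (p *m DW_matrix p eps) = second_moment p ->
  p = p *m DW_matrix p eps.
Proof.
case=> p_ge0 _; rewrite /second_moment sum_step => /eqP.
have term_ge0 i k : 0 <= p 0 i * p 0 k * defect (fun j => (j : nat)%:R ^+ 2 : R) i k.
  by rewrite !mulr_ge0 ?sqr_defect_ge0.
rewrite eq_sym -subr_eq0 opprB addrC subrK mulf_eq0 invr_eq0 pnatr_eq0 /=.
rewrite psumr_eq0 => [/allP sum0|i _]; last by apply: sumr_ge0.
(* For distant pairs the vanishing term of the second moment kills p_i p_k itself, so the test
   function f can be arbitrary. *)
have defect0 f i k : near eps i k -> p 0 i * p 0 k * defect f i k = 0.
  move=> near_ik.
  have [/andP[ik ki]|far] := boolP ((i <= k.+1) && (k <= i.+1))%N.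
    by rewrite defect_eq0 ?mulr0.
  have /= := sum0 i (mem_index_enum i).
  rewrite psumr_eq0 // => /allP /(_ k (mem_index_enum k)).
  rewrite near_ik /= mulf_eq0 (gt_eqF (sqr_defect_gt0 R far)) orbF.
  by move=> /eqP ->; rewrite mul0r.
apply/rowP => j; have coord (q : 'rV[R]_n) : \sum_i q 0 i * (j == i)%:R = q 0 j.
  by rewrite -[RHS](sum_indicator (q 0)); apply: eq_bigr => i _; rewrite mulrC.
have := sum_step p eps (fun i => (j == i)%:R).
rewrite [X in _ - _ * X]big1 => [|i _]; last by rewrite big1 // => k /defect0.
by rewrite mulr0 subr0 !coord.
Qed.

Unset Implicit Arguments.

Theorem theorem4 (R : realType) (n eps : nat)
  (n_gt0 : (0 < n)%N) (eps_gt0 : (0 < eps)%N)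
  (p : nat -> 'rV[R]_n)
  (p0_simplex : in_simplex (p 0%N))
  (p_chain : forall t : nat, p t.+1 = p t *m DW_matrix (p t) eps)
  (t T : nat) (T_ge1 : (1 <= T)%N) (p_periodic : p (t + T)%N = p t) :
  p t = p t *m DW_matrix (p t) eps.
Proof.
have ps s : in_simplex (p s).
  by elim: s => // s IHs; rewrite p_chain; apply: in_simplex_step.
have le_step s : second_moment (p s.+1) <= second_moment (p s).
  by rewrite p_chain second_moment_step_le.
have le_steps s d : second_moment (p (s + d)%N) <= second_moment (p s).
  elim: d => [|d IHd]; first by rewrite addn0.
  by rewrite addnS (le_trans (le_step _)).
apply: second_moment_step_eq => //; rewrite -p_chain; apply/eqP.
(* Time t + T is reached from t + 1 in T - 1 further steps, so the second moment at t, equal to that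
   at t + T, is at most that at t + 1. *)
by rewrite eq_le le_step -{1}p_periodic -(prednK T_ge1) -addSnnS le_steps.
Qed.
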